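(* If $(x^*,y^* )\in\mathbb{R}^n\times\mathbb{R}^n$ is a local minimizer of the relaxed problem (RP), then $(x^*,y^* )$ is an $AW$-stationary point for (RP).
   Context: Setting. Let $\alpha,n$ be natural numbers with $0<\alpha<n$, and let $f:\mathbb{R}^n\to\mathbb{R}$, $g:\mathbb{R}^n\to\mathbb{R}^m$, $h:\mathbb{R}^n\to\mathbb{R}^p$ be continuously differentiable. Let $e=(1,\ldots,1)\in\mathbb{R}^n$ and define $\theta(y)=n-\alpha-e^Ty\in\mathbb{R}$, $G(x)=x$, $H(y)=-y$, $\tilde H(y)=y-e$ for $x,y\in\mathbb{R}^n$. Let $*$ denote the componentwise (Hadamard) product; vector inequalities and the minimum $\min\{\cdot,\cdot\}$ of vectors are taken componentwise. The relaxed problem (RP) (a continuous reformulation of minimizing $f(x)$ subject to $g(x)\le 0$, $h(x)=0$ and $x$ having at most $\alpha$ nonzero components) is: minimize $f(x)$ over $(x,y)\in\mathbb{R}^n\times\mathbb{R}^n$ subject to $g(x)\le 0$, $h(x)=0$, $\theta(y)\le 0$, $H(y)\le 0$, $\tilde H(y)\le 0$, $G(x)*H(y)=0$. Let $L(x,\lambda^g,\lambda^h)=f(x)+(\lambda^g)^Tg(x)+(\lambda^h)^Th(x)$ and, for $\lambda=(\lambda^g,\lambda^h,\lambda^\theta,\lambda^G,\lambda^H,\lambda^{\tilde H})$, let $$\mathcal{L}(x,y,\lambda)=L(x,\lambda^g,\lambda^h)+\lambda^\theta\theta(y)+(\lambda^G)^TG(x)+(\lambda^H)^TH(y)+(\lambda^{\tilde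 H})^T\tilde H(y).$$ Definition ($AW$-stationarity). A feasible point $(\bar x,\bar y)$ of (RP) is called $AW$-stationary (Approximately Weakly stationary) for (RP) if there exist sequences $(x^k,y^k)\subset\mathbb{R}^n\times\mathbb{R}^n$ and $\lambda^k=(\lambda^{g,k},\lambda^{h,k},\lambda^{\theta,k},\lambda^{G,k},\lambda^{H,k},\lambda^{\tilde H,k})\in\mathbb{R}_+^m\times\mathbb{R}^p\times\mathbb{R}_+\times\mathbb{R}^n\times\mathbb{R}^n\times\mathbb{R}_+^n$ such that, as $k\to\infty$: (1) $(x^k,y^k)\to(\bar x,\bar y)$; (2) $\nabla_{x,y}\mathcal{L}(x^k,y^k,\lambda^k)\to 0$; (3) $\min\{-g(x^k),\lambda^{g,k}\}\to 0$; (4) $\min\{-\theta(y^k),\lambda^{\theta,k}\}\to 0$; (5) $\min\{|G_i(x^k)|,|\lambda_i^{G,k}|\}\to 0$ for all $i=1,\ldots,n$; (6) $\min\{-H_i(y^k),|\lambda_i^{H,k}|\}\to 0$ for all $i=1,\ldots,n$; (7) $\min\{-\tilde H(y^k),\lambda^{\tilde H,k}\}\to 0$. *)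

(* Defs.v *)
From HB Require Import structures.
From mathcomp Require Import all_boot all_order all_algebra.
From mathcomp Require Import all_classical all_reals all_analysis.

Set Implicit Arguments.
Unset Strict Implicit.
Unset Printing Implicit Defensive.

Import Order.TTheory GRing.Theory Num.Theory.
Import numFieldNormedType.Exports.

Local Open Scope classical_set_scope.
Local Open Scope ring_scope.

(* Vectors of R^n are row vectors. *)

Definition dotv (R : realType) (n : nat) (u v : 'rV[R]_n) : R :=
  (u *m v^T) 0 0.

Definition lev (R : realType) (n : nat) (u v : 'rV[R]_n) : Prop :=
  forall i : 'I_n, u 0 i <= v 0 i.

Definition hadamard (R : realType) (n : nat) (u v : 'rV[R]_n) : 'rV[R]_n :=
  map2_mx *%R u v.

Definition minv (R : realType) (n : nat) (u v : 'rV[R]_n) : 'rV[R]_n :=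
  map2_mx Num.min u v.

Definition grad (R : realType) (n : nat) (f : 'rV[R]_n -> R) (x : 'rV[R]_n) :
    'rV[R]_n :=
  \row_i 'D_(delta_mx 0 i) f x.

(* The partial derivatives are the values of 'd f x on the standard basis, so
   their continuity amounts to the continuity of x |-> 'd f x. *)
Definition continuously_differentiable (R : realType) (n : nat)
    (W : normedModType R) (f : 'rV[R]_n -> W) : Prop :=
  (forall x : 'rV[R]_n, differentiable f x) /\
  (forall i : 'I_n, continuous (fun x : 'rV[R]_n => 'D_(delta_mx 0 i) f x)).

Definition local_minimizer (R : realType) (T : topologicalType)
    (F : T -> R) (S : set T) (z : T) : Prop :=
  S z /\ \forall w \near z, S w -> F z <= F w.

Definition ones (R : realType) (n : nat) : 'rV[R]_n := const_mx 1.

Definition theta (R : realType) (n alpha : nat) (y : 'rV[R]_n) : R :=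
  n%:R - alpha%:R - dotv (ones R n) y.

Definition Gmap (R : realType) (n : nat) (x : 'rV[R]_n) : 'rV[R]_n := x.

Definition Hmap (R : realType) (n : nat) (y : 'rV[R]_n) : 'rV[R]_n := - y.

Definition Htmap (R : realType) (n : nat) (y : 'rV[R]_n) : 'rV[R]_n :=
  y - ones R n.

Definition RP_feasible (R : realType) (n m p alpha : nat)
    (g : 'rV[R]_n -> 'rV[R]_m) (h : 'rV[R]_n -> 'rV[R]_p) :
    set ('rV[R]_n * 'rV[R]_n) :=
  [set z | [/\ lev (g z.1) 0, h z.1 = 0 & theta alpha z.2 <= 0] /\
           [/\ lev (Hmap z.2) 0, lev (Htmap z.2) 0 &
               hadamard (Gmap z.1) (Hmap z.2) = 0]].

Definition RP_local_minimizer (R : realType) (n m p alpha : nat)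
    (f : 'rV[R]_n -> R) (g : 'rV[R]_n -> 'rV[R]_m) (h : 'rV[R]_n -> 'rV[R]_p)
    (z : 'rV[R]_n * 'rV[R]_n) : Prop :=
  local_minimizer (fun w : 'rV[R]_n * 'rV[R]_n => f w.1)
    (RP_feasible alpha g h) z.

Record multipliers (R : realType) (n m p : nat) : Type := Multipliers {
  mult_g : 'rV[R]_m;
  mult_h : 'rV[R]_p;
  mult_theta : R;
  mult_G : 'rV[R]_n;
  mult_H : 'rV[R]_n;
  mult_Ht : 'rV[R]_n
}.

Definition lagrangianL (R : realType) (n m p : nat)
    (f : 'rV[R]_n -> R) (g : 'rV[R]_n -> 'rV[R]_m) (h : 'rV[R]_n -> 'rV[R]_p)
    (x : 'rV[R]_n) (lg : 'rV[R]_m) (lh : 'rV[R]_p) : R :=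
  f x + dotv lg (g x) + dotv lh (h x).

Definition lagrangian (R : realType) (n m p alpha : nat)
    (f : 'rV[R]_n -> R) (g : 'rV[R]_n -> 'rV[R]_m) (h : 'rV[R]_n -> 'rV[R]_p)
    (x y : 'rV[R]_n) (l : multipliers R n m p) : R :=
  lagrangianL f g h x (mult_g l) (mult_h l)
  + mult_theta l * theta alpha y
  + dotv (mult_G l) (Gmap x)
  + dotv (mult_H l) (Hmap y)
  + dotv (mult_Ht l) (Htmap y).

Definition grad_lagrangian (R : realType) (n m p alpha : nat)
    (f : 'rV[R]_n -> R) (g : 'rV[R]_n -> 'rV[R]_m) (h : 'rV[R]_n -> 'rV[R]_p)
    (x y : 'rV[R]_n) (l : multipliers R n m p) : 'rV[R]_n * 'rV[R]_n :=
  (grad (fun u : 'rV[R]_n => lagrangian alpha f g h u y l) x,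
   grad (fun v : 'rV[R]_n => lagrangian alpha f g h x v l) y).

Definition AW_stationary (R : realType) (n m p alpha : nat)
    (f : 'rV[R]_n -> R) (g : 'rV[R]_n -> 'rV[R]_m) (h : 'rV[R]_n -> 'rV[R]_p)
    (z : 'rV[R]_n * 'rV[R]_n) : Prop :=
  RP_feasible alpha g h z /\
  exists (x y : nat -> 'rV[R]_n) (l : nat -> multipliers R n m p),
    (forall k : nat, [/\ lev 0 (mult_g (l k)), 0 <= mult_theta (l k) &
                         lev 0 (mult_Ht (l k))]) /\
    (x k, y k) @[k --> \oo] --> z /\
    grad_lagrangian alpha f g h (x k) (y k) (l k) @[k --> \oo]
      --> (0 : 'rV[R]_n * 'rV[R]_n) /\
    minv (- g (x k)) (mult_g (l k)) @[k --> \oo] --> (0 : 'rV[R]_m) /\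
    Num.min (- theta alpha (y k)) (mult_theta (l k)) @[k --> \oo]
      --> (0 : R) /\
    (forall i : 'I_n,
      Num.min `|Gmap (x k) 0 i| `|mult_G (l k) 0 i| @[k --> \oo]
        --> (0 : R)) /\
    (forall i : 'I_n,
      Num.min (- Hmap (y k) 0 i) `|mult_H (l k) 0 i| @[k --> \oo]
        --> (0 : R)) /\
    minv (- Htmap (y k)) (mult_Ht (l k)) @[k --> \oo] --> (0 : 'rV[R]_n).

(* Main.v *)
Require Import Defs.
From HB Require Import structures.
From mathcomp Require Import all_boot all_order all_algebra.
From mathcomp Require Import all_classical all_reals all_analysis.
From mathcomp Require Import lra ring.
Import Order.TTheory GRing.Theory Num.Theory.
Import numFieldNormedType.Exports.
Local Open Scope classical_set_scope.
Local Open Scope ring_scope.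

(** Let I be the set of indices i with xs_i = 0. By complementarity ys_i = 0
    off I, so with y frozen at ys every x satisfying g x <= 0, h x = 0 and
    x_i = 0 on I is feasible, and xs is a local minimizer of f over such x. The
    multipliers of theta, H and H~ can then be 0, and it remains to find
    approximate KKT multipliers for a nonlinear program.  These come from a
    quadratic penalty: minimize f + rho (|max(g,0)|^2 + |h|^2) + |x - xs|^2 over
    a small box around xs in the face {x_i = xs_i on I}. For rho large the
    minimizer is interior to the box in the remaining directions, where the
    stationarity conditions read off the multipliers 2 rho max(g,0) and 2 rho h
    with residual 2 (x - xs); the multiplier of G absorbs the gradient on I. *)

(** * Directional derivatives through functions of one real variable *)

(** Both difference quotients are the same function of the increment. This carries one-variable
    rules over to directional derivatives. *)
Lemma is_derive_line (R : realType) (V W : normedModType R) (F : V -> W)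
    (x v : V) (t : R) (dF : W) :
  is_derive (x + t *: v) v F dF <->
  is_derive t (1 : R) (fun s : R => F (x + s *: v)) dF.
Proof.
have E : (fun s : R => s^-1 *: ((F \o shift (x + t *: v)) (s *: v) - F (x + t *: v))) =
  (fun s : R => s^-1 *: (((fun s : R => F (x + s *: v)) \o shift t) (s *: (1 : R)) -
    F (x + t *: v))).
  apply/funext => s /=; congr (_ *: (F _ - _)).
  by rewrite [s *: 1]mulr1 scalerDl addrCA.
have D : derivable F (x + t *: v) v = derivable (fun s : R => F (x + s *: v)) t (1 : R).
  by rewrite /derivable E.
have L : 'D_v F (x + t *: v) = 'D_(1 : R) (fun s : R => F (x + s *: v)) t.
  by rewrite /derive E.
by split=> -[d e]; apply: DeriveDef; rewrite -?e; move: d; rewrite ?D ?L.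
Qed.

(** Restricting [F] to the line through [x] along [v] reduces this to the one-variable chain rule,
    so only a derivative in the direction [v] is required of [F]. *)
Lemma is_derive_comp1 (R : realType) (V : normedModType R) (phi : R -> R)
    (F : V -> R) (x v : V) (a dF : R) :
  is_derive (F x) (1 : R) phi a -> is_derive x v F dF ->
  is_derive x v (fun u => phi (F u)) (a * dF).
Proof.
move=> dphi dFx; have := is_derive_line _ _ _ (fun u => phi (F u)) x v 0 (a * dF).
rewrite scale0r addr0 => ->.
have /is_derive_line H : is_derive (x + (0 : R) *: v) v F dF.
  by rewrite scale0r addr0.
apply: (is_derive1_comp (f := phi) _ H).
by rewrite scale0r addr0.
Qed.

(** Fermat's rule on one line: minimality is asked only along [v], so [x] may lie on the boundary of
    a constraint set in other directions. *)
Lemma derive_line_min (R : realType) (V : normedModType R) (F : V -> R)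
    (x v : V) (e : R) :
  0 < e -> (forall u, derivable F u v) ->
  (forall t : R, `|t| < e -> F x <= F (x + t *: v)) -> 'D_v F x = 0.
Proof.
move=> e0 dF Fmin.
have H : is_derive (0 : R) (1 : R) (fun s : R => F (x + s *: v)) 0.
  apply: (@derive1_at_min _ _ (- e) e 0); first by lra.
  - move=> t _; have /derivableP/is_derive_line := dF (x + t *: v).
    by case.
  - by rewrite in_itv /= oppr_lt0 e0.
  - move=> t; rewrite in_itv /= scale0r addr0 => /andP[t1 t2].
    by apply: Fmin; rewrite ltr_norml t1.
by have /is_derive_line := H; rewrite scale0r addr0 => -[].
Qed.

(** Squaring smooths the kink of the positive part at 0: the first-order remainder is at most the
    square of the increment, whatever the signs of [t] and [s + t]. *)
Lemma is_derive_sqr_pos (R : realType) (t : R) :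
  is_derive t (1 : R) (fun s : R => Num.max s 0 ^+ 2) (2 * Num.max t 0).
Proof.
have H : (fun s : R => s^-1 *: (((fun s : R => Num.max s 0 ^+ 2) \o shift t)
    (s *: (1 : R)) - Num.max t 0 ^+ 2)) @ 0^' --> 2 * Num.max t 0.
  apply/cvgrPdist_le => e e0; near=> s.
  have s0 : s != 0 by near: s; exact: nbhs_dnbhs_neq.
  have se : `|s| <= e by near: s; apply: dnbhs0_le.
  apply: le_trans se; rewrite /= [s *: 1]mulr1 [_ *: _]mulrC.
  have -> : 2 * Num.max t 0 - (Num.max (s + t) 0 ^+ 2 - Num.max t 0 ^+ 2) / s =
     (2 * s * Num.max t 0 - Num.max (s + t) 0 ^+ 2 + Num.max t 0 ^+ 2) / s by field.
  (* |max(s+t,0)^2 - max(t,0)^2 - 2 s max(t,0)| <= s^2 *)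
  rewrite normrM normfV ler_pdivrMr ?normr_gt0 // -expr2 real_normK ?num_real //.
  by case: (leP t 0) => ?; case: (leP (s + t) 0) => ?;
    rewrite ler_norml; apply/andP; split; nra.
by apply: DeriveDef; [apply/cvg_ex; eexists; exact: H|exact: cvg_lim].
Unshelve. all: by end_near. Qed.

(** * Coordinatewise limits, continuity and derivatives *)

Lemma dotvE (R : realType) (n : nat) (u v : 'rV[R]_n) :
  dotv u v = \sum_i u 0 i * v 0 i.
Proof. by rewrite /dotv mxE; apply: eq_bigr => i _; rewrite mxE. Qed.

Lemma dot0v (R : realType) (n : nat) (u : 'rV[R]_n) : dotv 0 u = 0.
Proof. by rewrite /dotv mul0mx mxE. Qed.

Lemma cvg_row (R : realType) (T : Type) (F : set_system T) (n : nat)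
    (u : T -> 'rV[R]_n) (l : 'rV[R]_n) : Filter F ->
  (forall i, u t 0 i @[t --> F] --> l 0 i) -> u t @[t --> F] --> l.
Proof.
move=> FF ul; apply/cvg_ballP => e e0.
have : forall i, \forall t \near F, ball (l 0 i) e (u t 0 i).
  by move=> i; have /cvg_ballP := ul i; apply.
move=> /filter_forall; apply: filterS => t lt; split=> // i j.
by rewrite ord1; exact: lt.
Qed.

Lemma cvg_pair_nbhs {T : Type} {U V : topologicalType} {F : set_system T}
    {FF : Filter F} {u : T -> U} {v : T -> V} {a : U} {b : V} :
  u t @[t --> F] --> a -> v t @[t --> F] --> b ->
  (u t, v t) @[t --> F] --> (a, b).
Proof. by move=> ua vb; exact: (cvg_pair ua vb). Qed.

Lemma is_derive_bigsum (R : realType) (V : normedModType R) (n : nat)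
    (F : 'I_n -> V -> R) (x v : V) (d : 'I_n -> R) :
  (forall i, is_derive x v (F i) (d i)) ->
  is_derive x v (fun u => \sum_i F i u) (\sum_i d i).
Proof.
move=> dF; rewrite (_ : (fun u => _) = \sum_i F i); first exact: is_derive_sum.
by apply/funext => u; rewrite fct_sumE.
Qed.

Lemma is_derive_coord (R : realType) (n : nat) (x v : 'rV[R]_n) (i : 'I_n) :
  is_derive x v (fun u : 'rV[R]_n => u 0 i) (v 0 i).
Proof.
have := is_derive_line _ _ _ (fun u : 'rV[R]_n => u 0 i) x v 0 (v 0 i).
rewrite scale0r addr0 => ->.
rewrite (_ : (fun s : R => _) = (fun s : R => x 0 i + s * v 0 i)).
  apply: (is_derive_eq (is_deriveD (is_derive_cst _ _ _)
    (is_deriveM (is_derive_id _ _) (is_derive_cst (v 0 i) _ _)))).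
  by rewrite scale0r !add0r [LHS]mulr1.
by apply/funext => s; rewrite !mxE.
Qed.

Lemma continuous_sumr (R : realType) (T : topologicalType) (n : nat)
    (F : 'I_n -> T -> R) :
  (forall i, continuous (F i)) -> continuous (fun x => \sum_i F i x).
Proof.
move=> cF; apply: (@continuous_big R _ +%R 0 xpredT) => [|i _].
  exact: add_continuous.
exact: cF.
Qed.

Lemma is_derive_component (R : realType) (V : normedModType R) (n : nat)
    (F : V -> 'rV[R]_n) (x v : V) (i : 'I_n) : differentiable F x ->
  is_derive x v (fun u => F u 0 i) ('D_v (fun u => F u 0 i) x).
Proof.
move=> dF; apply: derivableP.
exact: (iffLR (derivable_mxP F x v) (diff_derivable dF)).
Qed.

Lemma is_derive_sqrB (R : realType) (c t : R) :
  is_derive t (1 : R) (fun s : R => (s - c) ^+ 2) (2 * (t - c)).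
Proof.
have := is_deriveX 2 (is_deriveB (is_derive_id t (1 : R)) (is_derive_cst c t 1)).
by rewrite subr0 [_ *: 1]mulr1 expr1.
Qed.

Lemma continuous_component (R : realType) (V : normedModType R) (n : nat)
    (F : V -> 'rV[R]_n) (x : V) (i : 'I_n) : differentiable F x ->
  {for x, continuous (fun u => F u 0 i)}.
Proof.
move=> dF; apply: (@continuous_comp _ _ _ F (fun M : 'rV[R]_n => M 0 i)).
  exact: differentiable_continuous.
exact: coord_continuous.
Qed.

(** The right-hand side does not involve [rho], so approximate complementarity for [g] will follow
    even if the penalty parameters are unbounded. *)
Lemma min_opp_pos (R : realType) (t rho : R) : 0 <= rho ->
  Num.min (- t) (rho * (2 * Num.max t 0)) = - Num.max t 0.
Proof.
move=> rho0; case: (leP t 0) => t0.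
  by rewrite !mulr0 oppr0; apply/min_idPr; rewrite oppr_ge0.
apply/min_idPl; apply: (@le_trans _ _ 0); first by rewrite oppr_le0 ltW.
by rewrite !mulr_ge0 // ltW.
Qed.

(** * The quadratic penalty function and its constrained minimizers *)

Section Penalty.
Context (R : realType) (n m p : nat).
Context (f : 'rV[R]_n -> R) (g : 'rV[R]_n -> 'rV[R]_m) (h : 'rV[R]_n -> 'rV[R]_p).

Definition violation (x : 'rV[R]_n) : R :=
  \sum_j Num.max (g x 0 j) 0 ^+ 2 + \sum_l h x 0 l ^+ 2.

Definition sqdist (a x : 'rV[R]_n) : R := \sum_i (x 0 i - a 0 i) ^+ 2.

Definition penalized (a : 'rV[R]_n) (rho : R) (x : 'rV[R]_n) : R :=
  f x + rho * violation x + sqdist a x.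

Lemma violation_ge0 (x : 'rV[R]_n) : 0 <= violation x.
Proof. by rewrite addr_ge0 ?sumr_ge0 // => i _; exact: sqr_ge0. Qed.

Lemma sqr_le_sqdist (a x : 'rV[R]_n) (i : 'I_n) : (x 0 i - a 0 i) ^+ 2 <= sqdist a x.
Proof.
rewrite /sqdist (bigD1 i) //= lerDl sumr_ge0 // => j _; exact: sqr_ge0.
Qed.

Lemma sqdist_refl (a : 'rV[R]_n) : sqdist a a = 0.
Proof. by rewrite /sqdist big1 // => i _; rewrite subrr expr0n. Qed.

Lemma violation_eq0 (x : 'rV[R]_n) : violation x = 0 <-> lev (g x) 0 /\ h x = 0.
Proof.
split=> [|[gx hx]].
  move=> /eqP; rewrite paddr_eq0; [|by apply: sumr_ge0 => j _; exact: sqr_ge0..].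
  rewrite !psumr_eq0; [|by move=> j _; exact: sqr_ge0..].
  move=> /andP[/allP gx /allP hx]; split=> [j|].
    have := gx j (mem_index_enum _); rewrite /= sqrf_eq0 mxE.
    by case: (leP (g x 0 j) 0) => // g0; rewrite gt_eqF.
  apply/rowP => j; have := hx j (mem_index_enum _); rewrite /= sqrf_eq0 mxE.
  by move/eqP.
rewrite /violation !big1 ?addr0 // => j _; first by rewrite hx mxE expr0n.
by have := gx j; rewrite mxE => /max_idPr ->; rewrite expr0n.
Qed.

Context (df : forall x, differentiable f x) (dg : forall x, differentiable g x)
  (dh : forall x, differentiable h x).

Lemma continuous_violation : continuous violation.
Proof.
have c1 : continuous (fun u => \sum_j Num.max (g u 0 j) 0 ^+ 2).
  apply: continuous_sumr => j u.
  apply: (@continuous_comp _ _ _ (fun u => Num.max (g u 0 j) 0)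
    (fun s : R => s ^+ 2)); last exact: exprn_continuous.
  by apply: continuous_max; [exact: continuous_component|exact: cst_continuous].
have c2 : continuous (fun u => \sum_l h u 0 l ^+ 2).
  apply: continuous_sumr => l u.
  apply: (@continuous_comp _ _ _ (fun u => h u 0 l) (fun s : R => s ^+ 2));
    [exact: continuous_component|exact: exprn_continuous].
by move=> x; exact: cvgD (c1 x) (c2 x).
Qed.

Lemma continuous_sqdist (a : 'rV[R]_n) : continuous (sqdist a).
Proof.
apply: continuous_sumr => i x.
apply: (@continuous_comp _ _ _ (fun u : 'rV[R]_n => u 0 i - a 0 i)
  (fun s : R => s ^+ 2)); last exact: exprn_continuous.
exact: cvgB (@coord_continuous R _ _ 0 i x) (cvg_cst _).
Qed.

Lemma continuous_penalized (a : 'rV[R]_n) (rho : R) : continuous (penalized a rho).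
Proof.
move=> x; apply: (cvgD (cvgD _ _) (continuous_sqdist a x)).
  exact: differentiable_continuous.
exact: cvgM (cvg_cst _) (continuous_violation x).
Qed.

Lemma is_derive_lagrangianL (x v : 'rV[R]_n) (lg : 'rV[R]_m) (lh : 'rV[R]_p) :
  is_derive x v (fun u => lagrangianL f g h u lg lh)
   ('D_v f x + \sum_j lg 0 j * 'D_v (fun u => g u 0 j) x
     + \sum_l lh 0 l * 'D_v (fun u => h u 0 l) x).
Proof.
rewrite /lagrangianL; under eq_fun do rewrite !dotvE.
apply: is_deriveD; first apply: is_deriveD.
- by apply: derivableP; exact: diff_derivable.
- apply: is_derive_bigsum => j; apply: is_deriveZ.
  exact: is_derive_component.
- apply: is_derive_bigsum => j; apply: is_deriveZ.
  exact: is_derive_component.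
Qed.

(** By the chain rule, each squared penalty term contributes a multiplier evaluated at [x]. These
    multipliers stay frozen when the Lagrangian is differentiated in [u]. *)
Lemma is_derive_penalized (a : 'rV[R]_n) (rho : R) (x v : 'rV[R]_n) :
  is_derive x v (penalized a rho)
   ('D_v (fun u => lagrangianL f g h u
      (\row_j (rho * (2 * Num.max (g x 0 j) 0))) (\row_l (rho * (2 * h x 0 l)))) x
    + \sum_i 2 * (x 0 i - a 0 i) * v 0 i).
Proof.
rewrite (derive_val (is_derive := is_derive_lagrangianL _ _ _ _)).
apply: is_deriveD.
  rewrite -addrA.
  apply: is_deriveD; first by apply: derivableP; exact: diff_derivable.
  have -> : \sum_j (\row_j0 (rho * (2 * Num.max (g x 0 j0) 0))) 0 j * 'D_v (fun u => g u 0 j) x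
     + \sum_l (\row_l0 (rho * (2 * h x 0 l0))) 0 l * 'D_v (fun u => h u 0 l) x =
    rho * (\sum_j (2 * Num.max (g x 0 j) 0) * 'D_v (fun u => g u 0 j) x
     + \sum_l (2 * h x 0 l) * 'D_v (fun u => h u 0 l) x).
    rewrite mulrDr !mulr_sumr; congr (_ + _); apply: eq_bigr => j _;
      by rewrite mxE !mulrA.
  apply: is_deriveZ; apply: is_deriveD; apply: is_derive_bigsum => j.
  - apply: (is_derive_comp1 _ _ (fun s => Num.max s 0 ^+ 2)).
      exact: is_derive_sqr_pos.
    exact: is_derive_component.
  - apply: (is_derive_comp1 _ _ (fun s => s ^+ 2)).
      have := is_derive_sqrB _ 0 (h x 0 j).
      by rewrite subr0; under eq_fun do rewrite subr0.
    exact: is_derive_component.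
apply: is_derive_bigsum => i.
apply: (is_derive_comp1 _ _ (fun s => (s - a 0 i) ^+ 2) (fun u : 'rV[R]_n => u 0 i)).
  exact: is_derive_sqrB.
exact: is_derive_coord.
Qed.

(** Away from [a] in the box, the penalty beats [f a] at infeasible points and [sqdist] does so at
    feasible ones. Compactness makes one [rho] serve all of them, which confines the minimizer to a
    ball around [a]. *)
Lemma penalized_stationary (a : 'rV[R]_n) (I : pred 'I_n) (e : R) :
  0 < e -> lev (g a) 0 -> h a = 0 ->
  (\forall x \near a, lev (g x) 0 -> h x = 0 ->
     (forall i, I i -> x 0 i = a 0 i) -> f a <= f x) ->
  exists (x : 'rV[R]_n) (rho : R),
    [/\ 0 <= rho, forall i, I i -> x 0 i = a 0 i,
        forall i, `|x 0 i - a 0 i| <= e &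
        forall i, ~~ I i -> 'D_(delta_mx 0 i) (penalized a rho) x = 0].
Proof.
move=> e0 ga ha /nbhs_ballP[d /= d0 fmin].
have va : violation a = 0 by apply/violation_eq0.
(* The bound [e] gives the required closeness to [a]; [d / 2] keeps the closed box inside the open
   ball where [a] is minimal. *)
pose r := Num.min e (d / 2).
have r0 : 0 < r by rewrite lt_min e0 divr_gt0.
have rd : r < d by rewrite gt_min; apply/orP; right; lra.
(* Half-width 0 on [I] freezes those coordinates, so the face is still a product of segments and
   hence compact. *)
pose w i := if I i then 0 else r.
have w0 i : 0 <= w i by rewrite /w; case: (I i) => //; exact: ltW.
have wr i : w i <= r by rewrite /w; case: (I i) => //; exact: ltW.
pose B := [set x : 'rV[R]_n |
  forall i, [set` `[a 0 i - w i, a 0 i + w i]] (x 0 i)].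
have BE (x : 'rV[R]_n) : B x <-> forall i, `|x 0 i - a 0 i| <= w i.
  by split=> Bx i; have := Bx i; rewrite /= in_itv /= ler_distl.
have BI x : B x -> forall i, I i -> x 0 i = a 0 i.
  move=> /BE Bx i Ii; have := Bx i; rewrite /w Ii normr_le0 subr_eq0.
  by move/eqP.
have cB : compact B.
  apply: (@rV_compact R n (fun i => [set` `[a 0 i - w i, a 0 i + w i]])) => i.
  exact: segment_compact.
(* The part of the box outside the open Euclidean ball of radius [r]; a minimizer off [S] has every
   coordinate strictly within [r] of that of [a]. *)
pose S := B `&` [set x | r ^+ 2 <= sqdist a x].
have cS : compact S.
  apply: compact_closedI => //.
  apply: (@closed_comp _ _ (sqdist a) [set s | r ^+ 2 <= s]).
    by move=> x _; exact: continuous_sqdist.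
  exact: closed_ge.
(* The sets {f a < penalized a k} are open, increase with k and cover S. *)
have : \forall k \near \oo, S `<=` (fun x => f a < penalized a k%:R x).
  apply: (iffLR (compact_near_coveringP S) cS) => x [Bx rx].
  have [k0 k0P] : exists k0 : nat, f a < penalized a k0%:R x.
    have sx : 0 < sqdist a x by apply: lt_le_trans rx; rewrite exprn_gt0.
    (* With zero violation [x] is feasible, and [sx] makes the inequality strict already for
       [k0 = 0]. With positive violation the Archimedean property provides [k0]. *)
    have := violation_ge0 x; rewrite le_eqVlt => /orP[/eqP/esym v0|v0].
      exists 0%N; rewrite /penalized mul0r addr0.
      have /violation_eq0[gx hx] := v0.
      suff : f a <= f x by lra.
      apply: fmin (gx) (hx) (BI _ Bx); split=> // j i.
      rewrite ord1 /ball /= distrC; move/BE: Bx => /(_ i) /le_lt_trans; apply.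
      exact: le_lt_trans rd.
    have [k] : exists k : nat, (f a - f x) / violation x <= k%:R.
      exists (Num.bound `|(f a - f x) / violation x|).
      by rewrite (le_trans (ler_norm _)) // ltW // archi_boundP.
    rewrite ler_pdivrMr // => kP; exists k; rewrite /penalized; lra.
  exists ([set u | f a < penalized a k0%:R u], [set k | (k0 <= k)%N]).
    split; last by exists k0.
    exact: (cvgr_gt _ (continuous_penalized a k0%:R x)) _ k0P.
  move=> [u k] /= [uP kP]; apply: lt_le_trans uP _.
  by rewrite lerD2r lerD2l ler_wpM2r ?violation_ge0 ?ler_nat.
move=> /filter_ex[k kP].
have [||x /set_mem Bx xmin] := @EVT_min_rV R n (penalized a k%:R) B _ cB.
- by exists a; apply/BE => i; rewrite subrr normr0.
- by apply: continuous_subspaceT; exact: continuous_penalized.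
(* The point [a] lies in the box and has penalized value [f a], which every point of [S] exceeds; so
   the minimizer is not in [S]. *)
have sx : sqdist a x < r ^+ 2.
  rewrite ltNge; apply/negP => rx.
  have : f a < penalized a k%:R x by apply: kP.
  have /xmin : a \in B by apply/mem_set/BE => i; rewrite subrr normr0.
  by rewrite {2}/penalized va sqdist_refl mulr0 !addr0 leNgt => /negP.
exists x, k%:R; split => // [|i|i Ii]; first exact: BI.
  by move/BE: Bx => /(_ i) /le_trans; apply; rewrite (le_trans (wr i)) // ge_min lexx.
have xr : `|x 0 i - a 0 i| < r.
  rewrite -ltr_sqr ?nnegrE ?(ltW r0) // real_normK ?num_real //.
  exact: le_lt_trans (sqr_le_sqdist a x i) sx.
(* Moving coordinate [i] alone by less than its slack [r - |x_i - a_i|] stays in the box, whose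
   half-width in a direction off [I] is [r]. *)
apply: (@derive_line_min _ _ _ _ _ (r - `|x 0 i - a 0 i|)).
- by rewrite subr_gt0.
- by move=> u; have [] := is_derive_penalized a k%:R u (delta_mx 0 i).
move=> t tr; apply/xmin/mem_set/BE => j; rewrite !mxE eqxx /=.
case: (eqVneq j i) => [->|_]; last first.
  by rewrite mulr0 addr0; exact: (iffLR (BE x) Bx).
rewrite mulr1 /w (negbTE Ii) addrAC (le_trans (ler_normD _ _)) //.
by rewrite -lerBrDl ltW.
Qed.
End Penalty.

(** * Construction of the approximating sequences and multipliers *)

Theorem theorem3p10 (R : realType) (n m p alpha : nat)
    (alpha_gt0 : (0 < alpha)%N) (alpha_lt_n : (alpha < n)%N)
    (f : 'rV[R]_n -> R) (g : 'rV[R]_n -> 'rV[R]_m) (h : 'rV[R]_n -> 'rV[R]_p)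
    (f_C1 : continuously_differentiable f)
    (g_C1 : continuously_differentiable g)
    (h_C1 : continuously_differentiable h)
    (xs ys : 'rV[R]_n)
    (xys_min : RP_local_minimizer alpha f g h (xs, ys)) :
  AW_stationary alpha f g h (xs, ys).
Proof.
have [[df _] [dg _] [dh _]] := And3 f_C1 g_C1 h_C1.
have [feas fmin] := xys_min; split=> //.
have [[/= gxs hxs thys] [/= Hys Htys XY]] := feas.
pose I := [pred i | xs 0 i == 0].
have fminI : \forall x \near xs, lev (g x) 0 -> h x = 0 ->
    (forall i, I i -> x 0 i = xs 0 i) -> f xs <= f x.
  have xys : (x, ys) @[x --> xs] --> (xs, ys).
    exact: cvg_pair_nbhs cvg_id (cvg_cst _).
  have : \forall x \near xs, RP_feasible alpha g h (x, ys) -> f xs <= f x.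
    exact: xys _ fmin.
  apply: filterS => x xmin gx hx xI; apply: xmin.
  split; split=> //=; apply/rowP => i.
  (* Complementarity at the minimizer: either [i] is in [I], so that [x] also vanishes there, or
     [ys] vanishes at [i]. *)
  have /rowP/(_ i) := XY; rewrite /Gmap /Hmap !mxE => /eqP; rewrite mulf_eq0 => /orP[xi|].
    by rewrite xI // (eqP xi) mul0r.
  by move=> /eqP ->; rewrite mulr0.
(* The tolerance [1 / (k + 1)] forces convergence to [xs]; the penalty parameter [xr.2] is only
   known to be nonnegative. *)
have /choice[xr xrP] : forall k : nat, exists xr : 'rV[R]_n * R,
    [/\ 0 <= xr.2, forall i, I i -> xr.1 0 i = xs 0 i,
        forall i, `|xr.1 0 i - xs 0 i| <= k.+1%:R^-1 &
        forall i, ~~ I i ->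
          'D_(delta_mx 0 i) (penalized _ _ _ _ f g h xs xr.2) xr.1 = 0].
  move=> k; have [|x [rho P]] :=
    @penalized_stationary R n m p f g h df dg dh xs I k.+1%:R^-1 _ gxs hxs fminI.
    by rewrite invr_gt0.
  by exists (x, rho).
pose x k := (xr k).1; pose rho k := (xr k).2.
pose lg k : 'rV[R]_m := \row_j (rho k * (2 * Num.max (g (x k) 0 j) 0)).
pose lh k : 'rV[R]_p := \row_l (rho k * (2 * h (x k) 0 l)).
pose dL k i := 'D_(delta_mx 0 i) (fun u => lagrangianL f g h u (lg k) (lh k)) (x k).
(* On [I] the multiplier of [G] is free, since [x k] vanishes there, and is chosen to cancel the
   gradient. Off [I] it must be small, and 0 is taken. *)
pose lG k : 'rV[R]_n := \row_i (if I i then - dL k i else 0).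
(* Penalized stationarity along a basis vector keeps only the [i]-th summand of the derivative of
   [sqdist]. *)
have dLE k i : ~~ I i -> dL k i = - (2 * (x k 0 i - xs 0 i)).
  move=> Ii; have [_ _ _ /(_ i Ii)] := xrP k.
  rewrite (derive_val (is_derive := is_derive_penalized _ _ _ _ _ _ _ df dg dh _ _ _ _)).
  rewrite (bigD1 i) //= big1 => [|j ji]; last first.
    by rewrite !mxE (negbTE ji) mulr0.
  by rewrite !mxE !eqxx mulr1 addr0 => /eqP; rewrite addr_eq0 => /eqP.
have xi_cvg i : x k 0 i @[k --> \oo] --> xs 0 i.
  apply/cvgrPdist_le => e e0.
  have /cvgrPdist_le/(_ _ e0) := @cvg_harmonic R.
  apply: filterS => k; rewrite sub0r normrN /= => ke.
  have [_ _ /(_ i) xk _] := xrP k.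
  by rewrite distrC (le_trans xk) // (le_trans _ ke) // ler_norm.
have x_cvg : x k @[k --> \oo] --> xs by exact: cvg_row.
have grad_cvg : (\row_i if I i then 0 else - (2 * (x k 0 i - xs 0 i)))
    @[k --> \oo] --> (0 : 'rV[R]_n).
  apply: cvg_row => i; under eq_cvg do rewrite mxE; rewrite mxE.
  case: (boolP (I i)) => Ii; first exact: cvg_cst.
  apply/cvgrPdist_le => e e0.
  have /cvgrPdist_le/(_ (e / 2)) := xi_cvg i.
  rewrite divr_gt0 // => /(_ isT); apply: filterS => k.
  rewrite sub0r opprK normrM distrC [`|2|]ger0_norm //; lra.
(* The [y]-part is exactly zero, because with zero multipliers for [theta], [H] and [Ht] the
   Lagrangian does not depend on [y]. *)
have gradE k : grad_lagrangian alpha f g h (x k) ys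
    (Multipliers (lg k) (lh k) 0 (lG k) 0 0) =
    (\row_i (if I i then 0 else - (2 * (x k 0 i - xs 0 i))), 0).
  congr (_, _); apply/rowP => i; rewrite !mxE; last first.
    rewrite (_ : (fun v => _) = cst (lagrangianL f g h (x k) (lg k) (lh k) + dotv (lG k) (x k))).
      exact: derive_cst.
    by apply/funext => v; rewrite /lagrangian /= mul0r !dot0v !addr0.
  have dlag : is_derive (x k) (delta_mx 0 i : 'rV[R]_n) 
     (fun u => lagrangian alpha f g h u ys
        (Multipliers (lg k) (lh k) 0 (lG k) 0 0)) (dL k i + lG k 0 i).
    rewrite (_ : (fun v => _) = (fun u => lagrangianL f g h u (lg k) (lh k)) +
       (fun u => \sum_j lG k 0 j * u 0 j)); last first.
      apply/funext => v; rewrite /lagrangian /= mul0r !dot0v !addr0.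
      by congr (_ + _); exact: dotvE.
    apply: is_deriveD.
      rewrite /dL (derive_val (is_derive := is_derive_lagrangianL _ _ _ _ _ _ _ df dg dh _ _ _ _)).
      exact: is_derive_lagrangianL.
    rewrite (_ : lG k 0 i = \sum_j lG k 0 j * (delta_mx 0 i : 'rV[R]_n) 0 j).
      apply: is_derive_bigsum => j; apply: is_deriveZ.
      exact: is_derive_coord.
    rewrite (bigD1 i) //= big1 => [|j ji]; last first.
      by rewrite !mxE (negbTE ji) mulr0.
    by rewrite [delta_mx _ _ _ _]mxE !eqxx mulr1 addr0.
  rewrite (derive_val (is_derive := dlag)) mxE.
  by case: ifPn => Ii; [rewrite subrr|rewrite addr0 dLE].
exists x, (fun=> ys), (fun k => Multipliers (lg k) (lh k) 0 (lG k) 0 0).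
split=> [k|].
  split=> //= j; rewrite !mxE //.
  have [rho0 _ _ _] := xrP k.
  by rewrite !mulr_ge0 // le_max lexx orbT.
split; first exact: cvg_pair_nbhs x_cvg (cvg_cst _).
split.
  under eq_cvg do rewrite gradE.
  exact: cvg_pair_nbhs grad_cvg (cvg_cst _).
split.
  apply: cvg_row => j; rewrite mxE.
  (* The minimum reduces to minus the positive part of [g], which tends to 0 by continuity and
     feasibility of [xs]. *)
  have E k : minv (- g (x k)) (lg k) 0 j = - Num.max (g (x k) 0 j) 0.
    by rewrite !mxE min_opp_pos //; have [] := xrP k.
  under eq_cvg do rewrite E.
  have g0 : - Num.max (g xs 0 j) 0 = 0.
    by have := gxs j; rewrite mxE => /max_idPr ->; rewrite oppr0.
  have cg : {for xs, continuous (fun u => - Num.max (g u 0 j) 0)}.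
    apply: (@continuousN _ _ _ (fun u => Num.max (g u 0 j) 0)).
    apply: continuous_max; last exact: cst_continuous.
    exact: continuous_component.
  by move: cg; rewrite /prop_for /continuous_at g0; exact: cvg_comp x_cvg.
split.
  (* Feasibility of [ys] makes the minimum with the zero multiplier equal to 0 for each [k]; the
     conditions on [H] and [Ht] below work alike. *)
  under eq_cvg do rewrite /= min_r ?oppr_ge0 //.
  exact: cvg_cst.
split=> [i|].
  case: (boolP (I i)) => Ii.
    have E k : Num.min `|Gmap (x k) 0 i| `|lG k 0 i| = 0.
      have [_ /(_ i Ii) xi _ _] := xrP k.
      by rewrite /Gmap [x k 0 i]xi (eqP Ii) normr0 min_l.
    by under eq_cvg do rewrite E; exact: cvg_cst.
  under eq_cvg do rewrite /= [lG _ _ _]mxE (negbTE Ii) normr0 min_r //.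
  exact: cvg_cst.
split=> [i|].
  have E : Num.min (- Hmap ys 0 i) `|(0 : 'rV[R]_n) 0 i| = 0.
    rewrite [X in `|X|]mxE normr0 min_r // oppr_ge0.
    by have := Hys i; rewrite [X in _ <= X]mxE.
  by under eq_cvg do rewrite E; exact: cvg_cst.
apply: cvg_row => i; rewrite mxE.
have E : minv (- Htmap ys) (0 : 'rV[R]_n) 0 i = 0.
  rewrite 2!mxE min_r ?mxE //.
  by have := Htys i; rewrite !mxE oppr_ge0.
by under eq_cvg do rewrite E; exact: cvg_cst.
Qed.
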